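(* For any finite involutory quandle $X$, there is a monoidal 2-functor $$\mathrm{Col}_X:\mathcal{T}ang\to\mathbf{Mat}(\mathbb{N}),$$ where the target is the category of matrices with natural number entries, with identity 2-morphisms added. It sends the object $n$ to $|X|^n$ and a tangle diagram $T:m\to n$ to its coloring matrix, the $|X|^m\times|X|^n$ matrix whose entry $\mathrm{Col}_X(T)_{\mu\nu}$, for $\mu\in X^m$ and $\nu\in X^n$, is the number of $X$-colorings of $T$ that agree with $\mu$ on the incoming (lower) ends and with $\nu$ on the outgoing (upper) ends.
   Context: A quandle is a set $Q$ with two binary operations $\triangleright,\triangleleft$ such that for all $a,b,c\in Q$: (Q1) $a\triangleright a=a$; (Q2) $(b\triangleright a)\triangleleft b=a=b\triangleright(a\triangleleft b)$; (Q3) $a\triangleright(b\triangleright c)=(a\triangleright b)\triangleright(a\triangleright c)$. It is involutory if moreover $b\triangleright a=a\triangleleft b$ for all $a,b$. $\mathcal{T}ang$ is the strict monoidal 2-category of unoriented tangle diagrams. Its objects are the natural numbers, with $m\otimes n=m+n$. Its 1-morphisms $m\to n$ are tangle diagrams with $m$ endpoints on the bottom and $n$ on the top, built by composition and $\otimes$ from the generators $X^+,X^-:2\to2$ (right- and left-handed crossings; in $X^+$ the over-strand runs from bottom left to top right, in $X^-$ from bottom right to top left), $\cup:0\to2$ (local minimum) and $\cap:2\to0$ (local maximum), subject to the axioms of a strict monoidal category. Composition is written in diagrammatic order: for $T_1:m\to l$ and $T_2:l\to n$, $T_1\circ T_2:m\to n$ stacks $T_2$ on top of $T_1$; $\otimes$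 is side-by-side juxtaposition; $I_n$ is the identity on $n$. Its 2-morphisms are generated, under vertical and horizontal composition and $\otimes$, by freely adjoined 2-isomorphisms between the two sides of each of the following relations (local moves): $T_0$: $(\cup\otimes I_1)\circ(I_1\otimes\cap)= I_1=(I_1\otimes\cup)\circ(\cap\otimes I_1)$; $T_0'$: $(I_1\otimes\cup)\circ(X^\pm\otimes I_1)=(\cup\otimes I_1)\circ(I_1\otimes X^\mp)$; $T_1$: $\cup\circ X^\pm=\cup$; $T_2$: $X^\pm\circ X^\mp=I_2$; $T_3$: $(X^+\otimes I_1)\circ(I_1\otimes X^+)\circ(X^+\otimes I_1)=(I_1\otimes X^+)\circ(X^+\otimes I_1)\circ(I_1\otimes X^+)$. An arc of a tangle diagram is a maximal piece of the diagram whose ends are undercrossings or free endpoints (a closed component with no undercrossings counts as one arc). An $X$-coloring is an assignment of an element of $X$ to each arc such that at each crossing with over-arc colored $b$ and one under-arc colored $a$, the other under-arc is colored $b\triangleright a$ (independent of which under-arc is called the first, since $X$ is involutory). A coloring induces a tuple in $X^m$ on the lower endpoints and a tuple in $X^n$ on the upper endpoints. $\mathbf{Mat}(\mathbb{N})$ has the natural numbers as objects; a morphism $k\to l$ is a $k\times l$ matrix with entries in $\mathbb{N}$; composition (written in diagrammatic order) is matrix multiplication; the monoidal product is multiplication of natural numbers on objects and the Kronecker product on matrices; the only 2-morphisms are identities. The index sets $X^n$ are identified with $\{1,\dots,|X|^n\}$ lexicographically after fixing a total order on $X$. *)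

(* Defs.v *)
(* Classical logic (boolp) enters only through quotients by [Prop]-valued
   equivalence relations and through proof irrelevance. *)
From mathcomp Require Import all_boot all_order all_algebra.
From mathcomp Require Import generic_quotient boolp.
From mathcomp Require Import mxtens.

Set Implicit Arguments.
Unset Strict Implicit.
Unset Printing Implicit Defensive.

Import GRing.Theory.

Local Open Scope quotient_scope.

(* The strict laws relate cells whose boundaries are equal but not convertible:
   [(f (x) g) (x) h] and [f (x) (g (x) h)], say.  [heq1] and [heq2] are equality
   of 1-cells and of 2-cells together with their boundaries. *)
Inductive heq1 (O : Type) (H : O -> O -> Type) (a b : O) (f : H a b) :
    forall a' b', H a' b' -> Prop :=
  Heq1 : heq1 f f.

Inductive heq2 (O : Type) (H : O -> O -> Type)
    (H2 : forall a b, H a b -> H a b -> Type) (a b : O) (f g : H a b)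
    (x : H2 a b f g) :
    forall a' b' (f' g' : H a' b'), H2 a' b' f' g' -> Prop :=
  Heq2 : heq2 x x.

Section HeqTheory.
Variables (O : Type) (H : O -> O -> Type).

Lemma heq1_ob a b (f : H a b) a' b' (f' : H a' b') :
  heq1 f f' -> a = a' /\ b = b'.
Proof. by case. Qed.

Lemma heq1_cast a b (f : H a b) a' b' (f' : H a' b') : heq1 f f' ->
  exists (ea : a = a') (eb : b = b'),
    eq_rect b (H a') (eq_rect a (H^~ b) f a' ea) b' eb = f'.
Proof. by case; exists erefl, erefl. Qed.

Lemma heq1_eq a b (f f' : H a b) : heq1 f f' -> f = f'.
Proof.
move=> /heq1_cast[ea [eb <-]].
by rewrite (Prop_irrelevance ea erefl) (Prop_irrelevance eb erefl).
Qed.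

Lemma heq1_sym a b (f : H a b) a' b' (f' : H a' b') : heq1 f f' -> heq1 f' f.
Proof. by case. Qed.

Lemma heq1_trans a b (f : H a b) a' b' (f' : H a' b') a'' b'' (f'' : H a'' b'') :
  heq1 f f' -> heq1 f' f'' -> heq1 f f''.
Proof. by case. Qed.

(* When the only 2-cells are identities, the boundary determines the cell. *)
Lemma heq2_eq a b (f g : H a b) a' b' (f' g' : H a' b')
    (x : f = g) (y : f' = g') :
  heq1 f f' -> heq2 (H2 := fun a b (u v : H a b) => u = v) x y.
Proof.
move=> ff'; have [ea eb] := heq1_ob ff'; subst a' b'.
move: y; rewrite -(heq1_eq ff') => y.
by case: g / x; case: g' / y.
Qed.
End HeqTheory.

(* Composition of 1-cells and of 2-cells is in diagrammatic order. *)
Record twoCat := TwoCat {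
  ob :> Type;
  mor : ob -> ob -> Type;
  mor2 : forall a b, mor a b -> mor a b -> Type;
  id1 : forall a, mor a a;
  comp1 : forall a b c, mor a b -> mor b c -> mor a c;
  id2 : forall a b (f : mor a b), mor2 f f;
  vcomp : forall a b (f g h : mor a b), mor2 f g -> mor2 g h -> mor2 f h;
  hcomp : forall a b c (f f' : mor a b) (g g' : mor b c),
    mor2 f f' -> mor2 g g' -> mor2 (comp1 f g) (comp1 f' g');
  comp1A : forall a b c d (f : mor a b) (g : mor b c) (h : mor c d),
    comp1 (comp1 f g) h = comp1 f (comp1 g h);
  comp1_idl : forall a b (f : mor a b), comp1 (id1 a) f = f;
  comp1_idr : forall a b (f : mor a b), comp1 f (id1 b) = f;
  vcompA : forall a b (f g h k : mor a b)
      (x : mor2 f g) (y : mor2 g h) (z : mor2 h k),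
    vcomp (vcomp x y) z = vcomp x (vcomp y z);
  vcomp_idl : forall a b (f g : mor a b) (x : mor2 f g), vcomp (id2 f) x = x;
  vcomp_idr : forall a b (f g : mor a b) (x : mor2 f g), vcomp x (id2 g) = x;
  hcomp_id : forall a b c (f : mor a b) (g : mor b c),
    hcomp (id2 f) (id2 g) = id2 (comp1 f g);
  hcomp_vcomp : forall a b c (f f' f'' : mor a b) (g g' g'' : mor b c)
      (x : mor2 f f') (x' : mor2 f' f'') (y : mor2 g g') (y' : mor2 g' g''),
    hcomp (vcomp x x') (vcomp y y') = vcomp (hcomp x y) (hcomp x' y');
  hcompA : forall a b c d (f f' : mor a b) (g g' : mor b c) (h h' : mor c d)
      (x : mor2 f f') (y : mor2 g g') (z : mor2 h h'),
    heq2 (hcomp (hcomp x y) z) (hcomp x (hcomp y z));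
  hcomp_idl : forall a b (f g : mor a b) (x : mor2 f g),
    heq2 (hcomp (id2 (id1 a)) x) x;
  hcomp_idr : forall a b (f g : mor a b) (x : mor2 f g),
    heq2 (hcomp x (id2 (id1 b))) x
}.

Arguments id1 {t} a.
Arguments comp1 {t a b c} f g.
Arguments id2 {t a b} f.
Arguments vcomp {t a b f g h} x y.
Arguments hcomp {t a b c f f' g g'} x y.

(* A monoid in (2-Cat, x): the tensor is a strict 2-functor of two variables,
   strictly associative and unital on cells of all dimensions. *)
Record smon2Cat := Smon2Cat {
  base2 :> twoCat;
  unit0 : base2;
  tens0 : base2 -> base2 -> base2;
  tens1 : forall a b a' b' : base2,
    mor a b -> mor a' b' -> mor (tens0 a a') (tens0 b b');
  tens2 : forall (a b a' b' : base2) (f g : mor a b) (f' g' : mor a' b'),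
    mor2 f g -> mor2 f' g' -> mor2 (tens1 f f') (tens1 g g');
  tens1_id : forall a b : base2, tens1 (id1 a) (id1 b) = id1 (tens0 a b);
  tens1_comp : forall (a b c a' b' c' : base2)
      (f : mor a b) (g : mor b c) (f' : mor a' b') (g' : mor b' c'),
    tens1 (comp1 f g) (comp1 f' g') = comp1 (tens1 f f') (tens1 g g');
  tens2_id : forall (a b a' b' : base2) (f : mor a b) (f' : mor a' b'),
    tens2 (id2 f) (id2 f') = id2 (tens1 f f');
  tens2_vcomp : forall (a b a' b' : base2)
      (f g h : mor a b) (f' g' h' : mor a' b')
      (x : mor2 f g) (y : mor2 g h) (x' : mor2 f' g') (y' : mor2 g' h'),
    tens2 (vcomp x y) (vcomp x' y') = vcomp (tens2 x x') (tens2 y y');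
  tens2_hcomp : forall (a b c a' b' c' : base2)
      (f g : mor a b) (h k : mor b c) (f' g' : mor a' b') (h' k' : mor b' c')
      (x : mor2 f g) (y : mor2 h k) (x' : mor2 f' g') (y' : mor2 h' k'),
    heq2 (tens2 (hcomp x y) (hcomp x' y')) (hcomp (tens2 x x') (tens2 y y'));
  tens0A : forall a b c, tens0 (tens0 a b) c = tens0 a (tens0 b c);
  tens0_1l : forall a, tens0 unit0 a = a;
  tens0_1r : forall a, tens0 a unit0 = a;
  tens1A : forall (a a' b b' c c' : base2)
      (f : mor a a') (g : mor b b') (h : mor c c'),
    heq1 (tens1 (tens1 f g) h) (tens1 f (tens1 g h));
  tens1_1l : forall (a b : base2) (f : mor a b),
    heq1 (tens1 (id1 unit0) f) f;
  tens1_1r : forall (a b : base2) (f : mor a b),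
    heq1 (tens1 f (id1 unit0)) f;
  tens2A : forall (a a' b b' c c' : base2) (f f' : mor a a')
      (g g' : mor b b') (h h' : mor c c')
      (x : mor2 f f') (y : mor2 g g') (z : mor2 h h'),
    heq2 (tens2 (tens2 x y) z) (tens2 x (tens2 y z));
  tens2_1l : forall (a b : base2) (f g : mor a b) (x : mor2 f g),
    heq2 (tens2 (id2 (id1 unit0)) x) x;
  tens2_1r : forall (a b : base2) (f g : mor a b) (x : mor2 f g),
    heq2 (tens2 x (id2 (id1 unit0))) x
}.

Arguments unit0 {s}.
Arguments tens0 {s} a b.
Arguments tens1 {s a b a' b'} f f' : rename.
Arguments tens2 {s a b a' b' f g f' g'} x x' : rename.

Record twoFunctor (C D : twoCat) := TwoFunctor {
  fun0 :> C -> D;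
  fun1 : forall a b : C, mor a b -> mor (fun0 a) (fun0 b);
  fun2 : forall (a b : C) (f g : mor a b), mor2 f g -> mor2 (fun1 f) (fun1 g);
  fun1_id : forall a : C, fun1 (id1 a) = id1 (fun0 a);
  fun1_comp : forall (a b c : C) (f : mor a b) (g : mor b c),
    fun1 (comp1 f g) = comp1 (fun1 f) (fun1 g);
  fun2_id : forall (a b : C) (f : mor a b), fun2 (id2 f) = id2 (fun1 f);
  fun2_vcomp : forall (a b : C) (f g h : mor a b)
      (x : mor2 f g) (y : mor2 g h),
    fun2 (vcomp x y) = vcomp (fun2 x) (fun2 y);
  fun2_hcomp : forall (a b c : C) (f f' : mor a b) (g g' : mor b c)
      (x : mor2 f f') (y : mor2 g g'),
    heq2 (fun2 (hcomp x y)) (hcomp (fun2 x) (fun2 y))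
}.

Arguments fun1 {C D} t {a b} f.
Arguments fun2 {C D} t {a b f g} x.

Record mon2Functor (C D : smon2Cat) := Mon2Functor {
  base2F :> twoFunctor C D;
  funU : base2F unit0 = unit0;
  fun0_tens : forall a b : C, base2F (tens0 a b) = tens0 (base2F a) (base2F b);
  fun1_tens : forall (a b a' b' : C) (f : mor a b) (f' : mor a' b'),
    heq1 (fun1 base2F (tens1 f f')) (tens1 (fun1 base2F f) (fun1 base2F f'));
  fun2_tens : forall (a b a' b' : C) (f g : mor a b) (f' g' : mor a' b')
      (x : mor2 f g) (x' : mor2 f' g'),
    heq2 (fun2 base2F (tens2 x x')) (tens2 (fun2 base2F x) (fun2 base2F x'))
}.

Section Quot.
Variables (T : Type) (R : T -> T -> Prop).
Hypotheses (Rrefl : forall x, R x x) (Rsym : forall x y, R x y -> R y x).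
Hypothesis (Rtrans : forall x y z, R x y -> R y z -> R x z).

Definition brel (x y : {classic T}) : bool := `[< R x y >].

Lemma brel_refl : reflexive brel.
Proof. by move=> x; apply/asboolP. Qed.
Lemma brel_sym : symmetric brel.
Proof. by move=> x y; apply/asboolP/asboolP; apply: Rsym. Qed.
Lemma brel_trans : transitive brel.
Proof.
by move=> y x z /asboolP xy /asboolP yz; apply/asboolP; apply: Rtrans xy yz.
Qed.

Definition brel_equiv := EquivRel brel brel_refl brel_sym brel_trans.
Definition quot : Type := {eq_quot brel_equiv}.
Definition qcls (x : T) : quot := \pi_{eq_quot brel_equiv} (x : {classic T}).
Definition qrepr (q : quot) : T := repr (q : {eq_quot brel_equiv}).

Lemma qreprK q : qcls (qrepr q) = q.
Proof. exact: reprK. Qed.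
Lemma qclsP x y : qcls x = qcls y <-> R x y.
Proof.
by split=> [/(@eqmodP _ brel_equiv)/asboolP//|xy];
  apply/(@eqmodP _ brel_equiv)/asboolP.
Qed.
Lemma qrepr_cls x : R (qrepr (qcls x)) x.
Proof. by apply/qclsP; rewrite qreprK. Qed.
End Quot.

(* [DXp], [DXm] are the crossings whose over-strand runs from bottom left to top
   right, resp. from bottom right to top left; see [lower] and [upper]. *)
Inductive diag : nat -> nat -> Type :=
| DId n : diag n n
| DXp : diag 2 2
| DXm : diag 2 2
| DCup : diag 0 2
| DCap : diag 2 0
| DComp m l n : diag m l -> diag l n -> diag m n
| DTens m n m' n' : diag m n -> diag m' n' -> diag (m + m') (n + n').

(* The congruence generated by the axioms of a strict monoidal category. *)
Inductive deq : forall m n m' n', diag m n -> diag m' n' -> Prop :=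
| deq_refl m n (S : diag m n) : deq S S
| deq_sym m n m' n' (S : diag m n) (T : diag m' n') : deq S T -> deq T S
| deq_trans m n m' n' m'' n''
    (S : diag m n) (T : diag m' n') (U : diag m'' n'') :
    deq S T -> deq T U -> deq S U
| deq_comp m l n m' l' n' (S : diag m l) (T : diag l n)
    (S' : diag m' l') (T' : diag l' n') :
    deq S S' -> deq T T' -> deq (DComp S T) (DComp S' T')
| deq_tens m n p q m' n' p' q' (S : diag m n) (T : diag p q)
    (S' : diag m' n') (T' : diag p' q') :
    deq S S' -> deq T T' -> deq (DTens S T) (DTens S' T')
| deq_compA m k l n (S : diag m k) (T : diag k l) (U : diag l n) :
    deq (DComp (DComp S T) U) (DComp S (DComp T U))
| deq_comp_idl m n (S : diag m n) : deq (DComp (DId m) S) S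
| deq_comp_idr m n (S : diag m n) : deq (DComp S (DId n)) S
| deq_tens_id m n : deq (DTens (DId m) (DId n)) (DId (m + n))
| deq_tens_comp m l n m' l' n' (S : diag m l) (T : diag l n)
    (S' : diag m' l') (T' : diag l' n') :
    deq (DTens (DComp S T) (DComp S' T')) (DComp (DTens S S') (DTens T T'))
| deq_tensA m n p q r s (S : diag m n) (T : diag p q) (U : diag r s) :
    deq (DTens (DTens S T) U) (DTens S (DTens T U))
| deq_tens_1l m n (S : diag m n) : deq (DTens (DId 0) S) S
| deq_tens_1r m n (S : diag m n) : deq (DTens S (DId 0)) S.

Definition thom (m n : nat) : Type :=
  quot (@deq_refl m n) (@deq_sym m n m n) (@deq_trans m n m n m n).

(* The 1-morphism presented by a diagram. *)
Definition tcls m n (S : diag m n) : thom m n := qcls _ _ _ S.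
Definition trepr m n (f : thom m n) : diag m n := qrepr f.

Lemma treprK m n (f : thom m n) : tcls (trepr f) = f.
Proof. exact: qreprK. Qed.
Lemma trepr_cls m n (S : diag m n) : deq (trepr (tcls S)) S.
Proof. exact: qrepr_cls. Qed.

Lemma deq_dom m n m' n' (S : diag m n) (T : diag m' n') :
  deq S T -> m = m' /\ n = n'.
Proof.
elim=> // {m n m' n' S T}.
- by move=> m n m' n' S T _ [-> ->].
- by move=> m n m' n' m'' n'' S T U _ [-> ->] _ [-> ->].
- by move=> m l n m' l' n' S T S' T' _ [-> _] _ [_ ->].
- by move=> m n p q m' n' p' q' S T S' T' _ [-> ->] _ [-> ->].
- by move=> m n p q r s *; rewrite !addnA.
- by move=> m n S; rewrite !addn0.
Qed.

Lemma tclsP m n m' n' (S : diag m n) (T : diag m' n') :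
  deq S T -> heq1 (tcls S) (tcls T).
Proof.
move=> ST; have [em en] := deq_dom ST; subst m' n'.
by have -> : tcls S = tcls T by apply/qclsP.
Qed.

Lemma tclsE m n (S T : diag m n) : deq S T -> tcls S = tcls T.
Proof. by move=> ST; apply/qclsP. Qed.

Definition tid n : thom n n := tcls (DId n).
Definition tXp : thom 2 2 := tcls DXp.
Definition tXm : thom 2 2 := tcls DXm.
Definition tcup : thom 0 2 := tcls DCup.
Definition tcap : thom 2 0 := tcls DCap.
Definition tcomp m l n (f : thom m l) (g : thom l n) : thom m n :=
  tcls (DComp (trepr f) (trepr g)).
Definition ttens m n m' n' (f : thom m n) (f' : thom m' n') :
    thom (m + m') (n + n') :=
  tcls (DTens (trepr f) (trepr f')).

Lemma tcomp_cls m l n (S : diag m l) (T : diag l n) :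
  tcomp (tcls S) (tcls T) = tcls (DComp S T).
Proof. by apply: tclsE; apply: deq_comp; apply: trepr_cls. Qed.
Lemma ttens_cls m n m' n' (S : diag m n) (T : diag m' n') :
  ttens (tcls S) (tcls T) = tcls (DTens S T).
Proof. by apply: tclsE; apply: deq_tens; apply: trepr_cls. Qed.

Lemma tcompA m k l n (f : thom m k) (g : thom k l) (h : thom l n) :
  tcomp (tcomp f g) h = tcomp f (tcomp g h).
Proof.
rewrite -(treprK f) -(treprK g) -(treprK h) !tcomp_cls.
exact/tclsE/deq_compA.
Qed.
Lemma tcomp_idl m n (f : thom m n) : tcomp (tid m) f = f.
Proof. by rewrite -(treprK f) tcomp_cls; apply/tclsE/deq_comp_idl. Qed.
Lemma tcomp_idr m n (f : thom m n) : tcomp f (tid n) = f.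
Proof. by rewrite -(treprK f) tcomp_cls; apply/tclsE/deq_comp_idr. Qed.
Lemma ttens_id m n : ttens (tid m) (tid n) = tid (m + n).
Proof. by rewrite ttens_cls; apply/tclsE/deq_tens_id. Qed.
Lemma ttens_comp m l n m' l' n' (f : thom m l) (g : thom l n)
    (f' : thom m' l') (g' : thom l' n') :
  ttens (tcomp f g) (tcomp f' g') = tcomp (ttens f f') (ttens g g').
Proof.
rewrite -(treprK f) -(treprK g) -(treprK f') -(treprK g').
rewrite 2!tcomp_cls 3!ttens_cls tcomp_cls.
exact/tclsE/deq_tens_comp.
Qed.
Lemma ttensA m n p q r s (f : thom m n) (g : thom p q) (h : thom r s) :
  heq1 (ttens (ttens f g) h) (ttens f (ttens g h)).
Proof.
rewrite -(treprK f) -(treprK g) -(treprK h) !ttens_cls.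
exact/tclsP/deq_tensA.
Qed.
Lemma ttens_1l m n (f : thom m n) : heq1 (ttens (tid 0) f) f.
Proof. by rewrite -(treprK f) ttens_cls; apply/tclsP/deq_tens_1l. Qed.
Lemma ttens_1r m n (f : thom m n) : heq1 (ttens f (tid 0)) f.
Proof. by rewrite -(treprK f) ttens_cls; apply/tclsP/deq_tens_1r. Qed.

Local Notation "f ;; g" := (tcomp f g) (at level 40, left associativity).
Local Notation "f <x> g" := (ttens f g) (at level 40, left associativity).

Definition tX (e : bool) : thom 2 2 := if e then tXp else tXm.

(* In [tX], [true] is the sign [+]; [T0'], [T1], [T2] are pairs of moves, one for
   each choice of signs. *)
Inductive move : forall m n, thom m n -> thom m n -> Type :=
| T0l : @move 1 1 ((tcup <x> tid 1) ;; (tid 1 <x> tcap)) (tid 1)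
| T0r : @move 1 1 (tid 1) ((tid 1 <x> tcup) ;; (tcap <x> tid 1))
| T0' (e : bool) : @move 1 3 ((tid 1 <x> tcup) ;; (tX e <x> tid 1))
                             ((tcup <x> tid 1) ;; (tid 1 <x> tX (~~ e)))
| T1 (e : bool) : move (tcup ;; tX e) tcup
| T2 (e : bool) : move (tX e ;; tX (~~ e)) (tid 2)
| T3 : @move 3 3
    ((tXp <x> tid 1) ;; (tid 1 <x> tXp) ;; (tXp <x> tid 1))
    ((tid 1 <x> tXp) ;; (tXp <x> tid 1) ;; (tid 1 <x> tXp)).

Inductive cell : forall m n, thom m n -> thom m n -> Type :=
| CId m n (f : thom m n) : cell f f
| CMove m n (f g : thom m n) : move f g -> cell f g
| CInv m n (f g : thom m n) : move f g -> cell g f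
| CV m n (f g h : thom m n) : cell f g -> cell g h -> cell f h
| CH m l n (f f' : thom m l) (g g' : thom l n) :
    cell f f' -> cell g g' -> cell (tcomp f g) (tcomp f' g')
| CT m n m' n' (f g : thom m n) (f' g' : thom m' n') :
    cell f g -> cell f' g' -> cell (ttens f f') (ttens g g').

(* The congruence generated by the axioms of a strict monoidal 2-category,
   together with [CInv s] being a two-sided inverse of [CMove s]. *)
Inductive ceq : forall m n (f g : thom m n) m' n' (f' g' : thom m' n'),
    cell f g -> cell f' g' -> Prop :=
| ceq_refl m n (f g : thom m n) (x : cell f g) : ceq x x
| ceq_sym m n (f g : thom m n) m' n' (f' g' : thom m' n')
    (x : cell f g) (y : cell f' g') : ceq x y -> ceq y x
| ceq_trans m n (f g : thom m n) m' n' (f' g' : thom m' n')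
    m'' n'' (f'' g'' : thom m'' n'')
    (x : cell f g) (y : cell f' g') (z : cell f'' g'') :
    ceq x y -> ceq y z -> ceq x z
| ceq_v m n (f g h : thom m n) m' n' (f' g' h' : thom m' n')
    (x : cell f g) (y : cell g h) (x' : cell f' g') (y' : cell g' h') :
    ceq x x' -> ceq y y' -> ceq (CV x y) (CV x' y')
| ceq_h m l n (f g : thom m l) (h k : thom l n)
    m' l' n' (f' g' : thom m' l') (h' k' : thom l' n')
    (x : cell f g) (y : cell h k) (x' : cell f' g') (y' : cell h' k') :
    ceq x x' -> ceq y y' -> ceq (CH x y) (CH x' y')
| ceq_t m n p q (f g : thom m n) (h k : thom p q)
    m' n' p' q' (f' g' : thom m' n') (h' k' : thom p' q')
    (x : cell f g) (y : cell h k) (x' : cell f' g') (y' : cell h' k') :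
    ceq x x' -> ceq y y' -> ceq (CT x y) (CT x' y')
| ceq_moveV m n (f g : thom m n) (s : move f g) :
    ceq (CV (CMove s) (CInv s)) (CId f)
| ceq_Vmove m n (f g : thom m n) (s : move f g) :
    ceq (CV (CInv s) (CMove s)) (CId g)
| ceq_vA m n (f g h k : thom m n) (x : cell f g) (y : cell g h) (z : cell h k) :
    ceq (CV (CV x y) z) (CV x (CV y z))
| ceq_v_idl m n (f g : thom m n) (x : cell f g) : ceq (CV (CId f) x) x
| ceq_v_idr m n (f g : thom m n) (x : cell f g) : ceq (CV x (CId g)) x
| ceq_h_id m l n (f : thom m l) (g : thom l n) :
    ceq (CH (CId f) (CId g)) (CId (tcomp f g))
| ceq_h_v m l n (f f' f'' : thom m l) (g g' g'' : thom l n)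
    (x : cell f f') (x' : cell f' f'') (y : cell g g') (y' : cell g' g'') :
    ceq (CH (CV x x') (CV y y')) (CV (CH x y) (CH x' y'))
| ceq_hA m k l n (f f' : thom m k) (g g' : thom k l) (h h' : thom l n)
    (x : cell f f') (y : cell g g') (z : cell h h') :
    ceq (CH (CH x y) z) (CH x (CH y z))
| ceq_h_idl m n (f g : thom m n) (x : cell f g) : ceq (CH (CId (tid m)) x) x
| ceq_h_idr m n (f g : thom m n) (x : cell f g) : ceq (CH x (CId (tid n))) x
| ceq_t_id m n m' n' (f : thom m n) (f' : thom m' n') :
    ceq (CT (CId f) (CId f')) (CId (ttens f f'))
| ceq_t_v m n m' n' (f g h : thom m n) (f' g' h' : thom m' n')
    (x : cell f g) (y : cell g h) (x' : cell f' g') (y' : cell g' h') :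
    ceq (CT (CV x y) (CV x' y')) (CV (CT x x') (CT y y'))
| ceq_t_h m l n m' l' n' (f g : thom m l) (h k : thom l n)
    (f' g' : thom m' l') (h' k' : thom l' n')
    (x : cell f g) (y : cell h k) (x' : cell f' g') (y' : cell h' k') :
    ceq (CT (CH x y) (CH x' y')) (CH (CT x x') (CT y y'))
| ceq_tA m n p q r s (f f' : thom m n) (g g' : thom p q) (h h' : thom r s)
    (x : cell f f') (y : cell g g') (z : cell h h') :
    ceq (CT (CT x y) z) (CT x (CT y z))
| ceq_t_1l m n (f g : thom m n) (x : cell f g) : ceq (CT (CId (tid 0)) x) x
| ceq_t_1r m n (f g : thom m n) (x : cell f g) : ceq (CT x (CId (tid 0))) x.

Definition thom2 m n (f g : thom m n) : Type :=
  quot (@ceq_refl m n f g) (@ceq_sym m n f g m n f g)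
       (@ceq_trans m n f g m n f g m n f g).
Definition ccls m n (f g : thom m n) (x : cell f g) : thom2 f g := qcls _ _ _ x.
Definition crepr m n (f g : thom m n) (x : thom2 f g) : cell f g := qrepr x.

Lemma creprK m n (f g : thom m n) (x : thom2 f g) : ccls (crepr x) = x.
Proof. exact: qreprK. Qed.
Lemma crepr_cls m n (f g : thom m n) (x : cell f g) : ceq (crepr (ccls x)) x.
Proof. exact: qrepr_cls. Qed.

Lemma heq1_tcomp m l n (f : thom m l) (g : thom l n)
    m' l' n' (f' : thom m' l') (g' : thom l' n') :
  heq1 f f' -> heq1 g g' -> heq1 (tcomp f g) (tcomp f' g').
Proof.
move=> ff' gg'; have [em el] := heq1_ob ff'; have [_ en] := heq1_ob gg'.
by subst m' l' n'; rewrite (heq1_eq ff') (heq1_eq gg').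
Qed.

Lemma heq1_ttens m n p q (f : thom m n) (g : thom p q)
    m' n' p' q' (f' : thom m' n') (g' : thom p' q') :
  heq1 f f' -> heq1 g g' -> heq1 (ttens f g) (ttens f' g').
Proof. by case=> {m' n' f'}; case. Qed.

Lemma ceq_bnd m n (f g : thom m n) m' n' (f' g' : thom m' n')
    (x : cell f g) (y : cell f' g') :
  ceq x y -> heq1 f f' /\ heq1 g g'.
Proof.
elim=> {m n f g m' n' f' g' x y}.
- by [].
- by move=> *; split; apply: heq1_sym; tauto.
- by move=> ? ? f g ? ? f' g' ? ? f'' g'' _ _ _ _ [? ?] _ [? ?]; split;
    [apply: (heq1_trans (f' := f')) | apply: (heq1_trans (f' := g'))].
- by move=> *; tauto.
- by move=> *; split; apply: heq1_tcomp; tauto.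
- by move=> *; split; apply: heq1_ttens; tauto.
- by [].
- by [].
- by [].
- by [].
- by [].
- by [].
- by [].
- by move=> *; rewrite !tcompA.
- by move=> *; rewrite !tcomp_idl.
- by move=> *; rewrite !tcomp_idr.
- by [].
- by [].
- by move=> *; rewrite !ttens_comp.
- by move=> *; split; apply: ttensA.
- by move=> *; split; apply: ttens_1l.
- by move=> *; split; apply: ttens_1r.
Qed.

Lemma cclsP m n (f g : thom m n) m' n' (f' g' : thom m' n')
    (x : cell f g) (y : cell f' g') :
  ceq x y -> heq2 (H2 := @thom2) (ccls x) (ccls y).
Proof.
move=> xy; have [ff' gg'] := ceq_bnd xy.
have [em en] := heq1_ob ff'; subst m' n'.
have ef := heq1_eq ff'; have eg := heq1_eq gg'; subst f' g'.
by have -> : ccls x = ccls y by apply/qclsP.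
Qed.

Lemma cclsE m n (f g : thom m n) (x y : cell f g) : ceq x y -> ccls x = ccls y.
Proof. by move=> xy; apply/qclsP. Qed.

Definition cid m n (f : thom m n) : thom2 f f := ccls (CId f).
Definition cv m n (f g h : thom m n) (x : thom2 f g) (y : thom2 g h) :
  thom2 f h := ccls (CV (crepr x) (crepr y)).
Definition ch m l n (f f' : thom m l) (g g' : thom l n)
  (x : thom2 f f') (y : thom2 g g') : thom2 (tcomp f g) (tcomp f' g') :=
  ccls (CH (crepr x) (crepr y)).
Definition ct m n m' n' (f g : thom m n) (f' g' : thom m' n')
  (x : thom2 f g) (y : thom2 f' g') : thom2 (ttens f f') (ttens g g') :=
  ccls (CT (crepr x) (crepr y)).

Lemma cv_cls m n (f g h : thom m n) (x : cell f g) (y : cell g h) :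
  cv (ccls x) (ccls y) = ccls (CV x y).
Proof. by apply: cclsE; apply: ceq_v; apply: crepr_cls. Qed.
Lemma ch_cls m l n (f f' : thom m l) (g g' : thom l n)
    (x : cell f f') (y : cell g g') :
  ch (ccls x) (ccls y) = ccls (CH x y).
Proof. by apply: cclsE; apply: ceq_h; apply: crepr_cls. Qed.
Lemma ct_cls m n m' n' (f g : thom m n) (f' g' : thom m' n')
    (x : cell f g) (y : cell f' g') :
  ct (ccls x) (ccls y) = ccls (CT x y).
Proof. by apply: cclsE; apply: ceq_t; apply: crepr_cls. Qed.
Definition c_cls := (cv_cls, ch_cls, ct_cls).

Definition tang2 : twoCat.
Proof.
apply: (@TwoCat nat thom (@thom2) tid (@tcomp) (@cid) (@cv) (@ch)).
- exact: tcompA.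
- exact: tcomp_idl.
- exact: tcomp_idr.
- move=> a b f g h k x y z; rewrite -(creprK x) -(creprK y) -(creprK z).
  by rewrite !c_cls; apply/cclsE/ceq_vA.
- by move=> a b f g x; rewrite -(creprK x) c_cls; apply/cclsE/ceq_v_idl.
- by move=> a b f g x; rewrite -(creprK x) c_cls; apply/cclsE/ceq_v_idr.
- by move=> a b c f g; rewrite c_cls; apply/cclsE/ceq_h_id.
- move=> a b c f f' f'' g g' g'' x x' y y'.
  rewrite -(creprK x) -(creprK x') -(creprK y) -(creprK y').
  by rewrite !c_cls; apply/cclsE/ceq_h_v.
- move=> a b c d f f' g g' h h' x y z.
  rewrite -(creprK x) -(creprK y) -(creprK z) !c_cls.
  exact/cclsP/ceq_hA.
- by move=> a b f g x; rewrite -(creprK x) c_cls; apply/cclsP/ceq_h_idl.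
- by move=> a b f g x; rewrite -(creprK x) c_cls; apply/cclsP/ceq_h_idr.
Defined.

Definition Tang : smon2Cat.
Proof.
apply: (@Smon2Cat tang2 0 addn (@ttens) (@ct)).
- exact: ttens_id.
- exact: ttens_comp.
- by move=> a b a' b' f f'; rewrite c_cls; apply/cclsE/ceq_t_id.
- move=> a b a' b' f g h f' g' h' x y x' y' /=.
  rewrite -(creprK x) -(creprK x') -(creprK y) -(creprK y').
  by rewrite !c_cls; apply/cclsE/ceq_t_v.
- move=> a b c a' b' c' f g h k f' g' h' k' x y x' y' /=.
  rewrite -(creprK x) -(creprK x') -(creprK y) -(creprK y').
  by rewrite !c_cls; apply/cclsP/ceq_t_h.
- by move=> a b c; rewrite addnA.
- by [].
- exact: addn0.
- exact: ttensA.
- exact: ttens_1l.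
- exact: ttens_1r.
- move=> a a' b b' c c' f f' g g' h h' x y z /=.
  rewrite -(creprK x) -(creprK y) -(creprK z) !c_cls.
  exact/cclsP/ceq_tA.
- by move=> a b f g x /=; rewrite -(creprK x) c_cls; apply/cclsP/ceq_t_1l.
- by move=> a b f g x /=; rewrite -(creprK x) c_cls; apply/cclsP/ceq_t_1r.
Defined.

Section Matrices.
Local Open Scope ring_scope.

(* [tensmx] of mxtens, which is restricted to rings. *)
Definition kronmx m n p q (A : 'M[nat]_(m, n)) (B : 'M[nat]_(p, q)) :
    'M[nat]_(m * p, n * q) :=
  \matrix_(i, j) (A (mxtens_unindex i).1 (mxtens_unindex j).1
                 * B (mxtens_unindex i).2 (mxtens_unindex j).2)%N.

Lemma kronmx_id m n : kronmx 1%:M 1%:M = 1%:M :> 'M[nat]_(m * n).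
Proof.
apply/matrixP=> i j; case: (mxtens_indexP i) => i1 i2.
case: (mxtens_indexP j) => j1 j2; rewrite !mxE !mxtens_indexK /=.
rewrite (can_eq (@mxtens_indexK _ _)) xpair_eqE.
by case: eqP; case: eqP.
Qed.

Lemma kronmx_mul m l n m' l' n' (A : 'M[nat]_(m, l)) (B : 'M[nat]_(l, n))
    (A' : 'M[nat]_(m', l')) (B' : 'M[nat]_(l', n')) :
  kronmx (A *m B) (A' *m B') = kronmx A A' *m kronmx B B'.
Proof.
apply/matrixP=> i j; case: (mxtens_indexP i) => i1 i2.
case: (mxtens_indexP j) => j1 j2; rewrite !mxE !mxtens_indexK /=.
rewrite big_distrlr /= pair_big /=.
rewrite (reindex (@mxtens_unindex l l')) /=; last first.
  by exists (@mxtens_index l l') => k _;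
    rewrite ?mxtens_indexK ?mxtens_unindexK.
by apply: eq_bigr => k _; rewrite !mxE !mxtens_indexK /= mulnACA.
Qed.

Lemma heq1_mx m n m' n' (A : 'M[nat]_(m, n)) (B : 'M[nat]_(m', n')) :
  m = m' -> n = n' ->
  (forall (i : 'I_m) (j : 'I_n) (i' : 'I_m') (j' : 'I_n'),
    i = i' :> nat -> j = j' :> nat -> A i j = B i' j') ->
  heq1 (H := fun m n => 'M[nat]_(m, n)) A B.
Proof.
move=> em en; subst m' n' => AB.
by have -> : A = B by apply/matrixP=> i j; apply: AB.
Qed.

Lemma kronmxA m n p q r s (A : 'M[nat]_(m, n)) (B : 'M[nat]_(p, q))
    (C : 'M[nat]_(r, s)) :
  heq1 (H := fun m n => 'M[nat]_(m, n))
    (kronmx (kronmx A B) C) (kronmx A (kronmx B C)).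
Proof.
apply: heq1_mx; rewrite ?mulnA // => i j.
case: (mxtens_indexP i) => i12 i3; case: (mxtens_indexP i12) => i1 i2.
case: (mxtens_indexP j) => j12 j3; case: (mxtens_indexP j12) => j1 j2.
move=> i' j' ei ej.
have -> : i' = mxtens_index (i1, mxtens_index (i2, i3)).
  by apply: val_inj; rewrite /= -ei /= mulnDl addnA mulnA.
have -> : j' = mxtens_index (j1, mxtens_index (j2, j3)).
  by apply: val_inj; rewrite /= -ej /= mulnDl addnA mulnA.
by rewrite !(mxE, mxtens_indexK) /= mulnA.
Qed.

Lemma kronmx_1l m n (A : 'M[nat]_(m, n)) :
  heq1 (H := fun m n => 'M[nat]_(m, n)) (kronmx (1%:M : 'M[nat]_1) A) A.
Proof.
apply: heq1_mx; rewrite ?mul1n // => i j.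
case: (mxtens_indexP i) => i1 i2; case: (mxtens_indexP j) => j1 j2.
move=> i' j' ei ej; rewrite !(mxE, mxtens_indexK) /= !ord1 eqxx mul1n.
by congr (A _ _); apply: val_inj; rewrite /= -?ei -?ej /= ord1.
Qed.

Lemma kronmx_1r m n (A : 'M[nat]_(m, n)) :
  heq1 (H := fun m n => 'M[nat]_(m, n)) (kronmx A (1%:M : 'M[nat]_1)) A.
Proof.
apply: heq1_mx; rewrite ?muln1 // => i j.
case: (mxtens_indexP i) => i1 i2; case: (mxtens_indexP j) => j1 j2.
move=> i' j' ei ej; rewrite !(mxE, mxtens_indexK) /= !ord1 eqxx muln1.
by congr (A _ _); apply: val_inj; rewrite /= -?ei -?ej /= ord1 addn0 muln1.
Qed.

(* The 2-cells [A => B] are the proofs of [A = B], so just the identities. *)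
Definition matN2 : twoCat.
Proof.
apply: (@TwoCat nat (fun k l => 'M[nat]_(k, l)) (fun k l A B => A = B)
  (fun k => 1%:M) (fun k l m A B => A *m B) (fun k l A => erefl A)
  (fun k l A B C x y => etrans x y)
  (fun k l m A A' B B' x y => f_equal2 mulmx x y)).
- by move=> *; rewrite mulmxA.
- by move=> *; rewrite mul1mx.
- by move=> *; rewrite mulmx1.
- by move=> * /=; apply: Prop_irrelevance.
- by move=> * /=; apply: Prop_irrelevance.
- by move=> * /=; apply: Prop_irrelevance.
- by move=> * /=; apply: Prop_irrelevance.
- by move=> * /=; apply: Prop_irrelevance.
- by move=> *; apply: heq2_eq; rewrite mulmxA.
- by move=> *; apply: heq2_eq; rewrite mul1mx.
- by move=> *; apply: heq2_eq; rewrite mulmx1.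
Defined.

Definition MatN : smon2Cat.
Proof.
apply: (@Smon2Cat matN2 1%N muln (@kronmx)
  (fun k l k' l' A B A' B' x y => f_equal2 (@kronmx k l k' l') x y)).
- by move=> *; apply: kronmx_id.
- by move=> *; apply: kronmx_mul.
- by move=> * /=; apply: Prop_irrelevance.
- by move=> * /=; apply: Prop_irrelevance.
- by move=> *; apply: heq2_eq; rewrite /= kronmx_mul.
- by move=> *; rewrite /= mulnA.
- exact: mul1n.
- exact: muln1.
- exact: kronmxA.
- exact: kronmx_1l.
- exact: kronmx_1r.
- by move=> *; apply/heq2_eq/kronmxA.
- by move=> *; apply/heq2_eq/kronmx_1l.
- by move=> *; apply/heq2_eq/kronmx_1r.
Defined.

End Matrices.

Record quandle (Q : Type) := Quandle {
  rtri : Q -> Q -> Q;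
  ltri : Q -> Q -> Q;
  quandle1 : forall a, rtri a a = a;
  quandle2l : forall a b, ltri (rtri b a) b = a;
  quandle2r : forall a b, rtri b (ltri a b) = a;
  quandle3 : forall a b c, rtri a (rtri b c) = rtri (rtri a b) (rtri a c)
}.

Definition involutory (Q : Type) (q : quandle Q) :=
  forall a b, rtri q b a = ltri q a b.

(* A diagram is cut into the elementary pieces of its generators; [glue]
   identifies the pieces that meet along a composition.  A crossing has three
   pieces: the over-strand and the lower and upper halves of the under-strand. *)
Fixpoint piece m n (T : diag m n) : finType :=
  match T with
  | DId n => 'I_n
  | DXp | DXm => option bool
  | DCup | DCap => unit
  | DComp _ _ _ D E => (piece D + piece E)%type
  | DTens _ _ _ _ D E => (piece D + piece E)%type
  end.

Definition over_piece : option bool := None.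
Definition under_lo : option bool := Some false.
Definition under_hi : option bool := Some true.

(* The piece at a lower, resp. upper, endpoint, numbered from the left. *)
Fixpoint lower m n (T : diag m n) : 'I_m -> piece T :=
  match T in diag m n return 'I_m -> piece T with
  | DId n => fun i => i
  | DXp => fun i => if i == ord0 then over_piece else under_lo
  | DXm => fun i => if i == ord0 then under_lo else over_piece
  | DCup => fun i => tt
  | DCap => fun i => tt
  | DComp _ _ _ D E => fun i => inl (lower D i)
  | DTens _ _ _ _ D E => fun i =>
      match split i with inl j => inl (lower D j) | inr j => inr (lower E j) end
  end.

Fixpoint upper m n (T : diag m n) : 'I_n -> piece T :=
  match T in diag m n return 'I_n -> piece T with
  | DId n => fun i => i
  | DXp => fun i => if i == ord0 then under_hi else over_piece
  | DXm => fun i => if i == ord0 then over_piece else under_hi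
  | DCup => fun i => tt
  | DCap => fun i => tt
  | DComp _ _ _ D E => fun i => inr (upper E i)
  | DTens _ _ _ _ D E => fun i =>
      match split i with inl j => inl (upper D j) | inr j => inr (upper E j) end
  end.

Fixpoint glue m n (T : diag m n) : rel (piece T) :=
  match T in diag m n return rel (piece T) with
  | DId _ | DXp | DXm | DCup | DCap => fun p q => false
  | DComp _ _ _ D E => fun p q =>
      match p, q with
      | inl a, inl b => glue a b
      | inr a, inr b => glue a b
      | inl a, inr b | inr b, inl a =>
          [exists i, (upper D i == a) && (lower E i == b)]
      end
  | DTens _ _ _ _ D E => fun p q =>
      match p, q with
      | inl a, inl b => glue a b
      | inr a, inr b => glue a b
      | inl _, inr _ | inr _, inl _ => false
      end
  end.

(* Arcs: the maximal connected unions of pieces.  Distinct under-halves of a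
   crossing are not glued there, so arcs end exactly at undercrossings and at
   endpoints. *)
Definition arc_set m n (T : diag m n) (p : piece T) : {set piece T} :=
  [set q | connect (@glue m n T) p q].

Definition arc m n (T : diag m n) : finType :=
  {A : {set piece T} | A \in [set arc_set p | p in [set: piece T]]}.

Definition arc_of m n (T : diag m n) (p : piece T) : arc T :=
  exist _ (arc_set p) (imset_f (@arc_set m n T) (in_setT p)).

(* Crossings, as triples (over, lower under, upper under).  [is_coloring] asks
   that [upper under = over |> lower under]; for an involutory quandle the roles
   of the two under-arcs are interchangeable. *)
Fixpoint crossings m n (T : diag m n) :
    seq (piece T * piece T * piece T) :=
  match T in diag m n return seq (piece T * piece T * piece T) with
  | DXp | DXm => [:: (over_piece, under_lo, under_hi)]
  | DId _ => [::]
  | DCup => [::]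
  | DCap => [::]
  | DComp _ _ _ D E =>
      [seq (inl x.1.1, inl x.1.2, inl x.2) | x <- crossings D] ++
      [seq (inr x.1.1, inr x.1.2, inr x.2) | x <- crossings E]
  | DTens _ _ _ _ D E =>
      [seq (inl x.1.1, inl x.1.2, inl x.2) | x <- crossings D] ++
      [seq (inr x.1.1, inr x.1.2, inr x.2) | x <- crossings E]
  end.

Section Coloring.
Variables (d : Order.disp_t) (X : finOrderType d) (q : quandle X).

Definition is_coloring m n (T : diag m n) (c : {ffun arc T -> X}) : bool :=
  all (fun x : piece T * piece T * piece T =>
    c (arc_of x.2) == rtri q (c (arc_of x.1.1)) (c (arc_of x.1.2)))
    (crossings T).

Definition lower_colors m n (T : diag m n) (c : {ffun arc T -> X}) :
    m.-tuple X := [tuple c (arc_of (lower T i)) | i < m].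
Definition upper_colors m n (T : diag m n) (c : {ffun arc T -> X}) :
    n.-tuple X := [tuple c (arc_of (upper T i)) | i < n].

Definition num_colorings m n (T : diag m n)
    (mu : m.-tuple X) (nu : n.-tuple X) : nat :=
  #|[set c : {ffun arc T -> X} | [&& is_coloring c,
       lower_colors c == mu & upper_colors c == nu]]|.

(* The [i]-th element of [X ^ n] in lexicographic order. *)
Definition lex_tuple n (i : 'I_(#|X| ^ n)) : n.-tuple X :=
  Order.enum_val (cast_ord (esym (card_tuple n X)) i : 'I_#|{: n.-tuplelexi X}|).

Definition coloring_mx m n (T : diag m n) : 'M[nat]_(#|X| ^ m, #|X| ^ n) :=
  \matrix_(i, j) num_colorings T (lex_tuple i) (lex_tuple j).
End Coloring.

(* Main.v *)
Require Import Defs.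
From mathcomp Require Import all_boot all_order all_algebra.
From mathcomp Require Import mxtens.
From mathcomp Require boolp.

Set Implicit Arguments.
Unset Strict Implicit.
Unset Printing Implicit Defensive.

(** The functor sends a 1-cell to the coloring matrix of any diagram presenting
    it.  Three facts make this a monoidal 2-functor.

    Colorings are local.  An arc is a connected component of the gluing relation
    on the pieces of a diagram, so a coloring of the arcs is the same as a
    coloring of the pieces that is constant along the gluing
    ([num_coloringsE]).  In this form a coloring of a composite is a pair of
    colorings with equal colors on the common endpoints, and a coloring of a
    juxtaposition is an arbitrary pair: counting gives a sum over the middle
    colors ([num_colorings_comp]) and a product ([num_colorings_tens]).

    The lexicographic numbering of [X ^ (m + n)] is the one that the Kronecker
    product uses on pairs ([lex_tuple_cat]), because concatenation is strictly
    increasing and a finite total order has only one increasing enumeration.  So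
    the counts above are matrix products and Kronecker products.  The axioms of a
    strict monoidal category then hold for coloring matrices because they hold
    in [MatN], and the matrix depends only on the 1-cell ([coloring_mx_deq]).

    The local moves preserve the matrix.  The colorings of a small diagram are
    parametrized by a finite set, with two maps reading off the lower and the
    upper colors ([presents]); such spans compose by pullback
    ([presents_comp]).  Each side of a move is then described by an explicit
    parametrization, and the two agree: identically for [T0l] and [T0r], by (Q1)
    for [T1], by involutivity for [T0'] and [T2], and by (Q3) for [T3].  As the
    2-cells of [MatN] are equalities of matrices, which are proof irrelevant, a
    cell of [Tang] goes to the equality that it yields ([tangle_mx_cell]), and all
    equations between 2-cells hold for free. *)

(** * Lexicographic enumeration of tuples *)

Section Lex.
Variables (d : Order.disp_t) (X : finOrderType d).
Import Order.DefaultSeqLexiOrder Order.TTheory.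

Lemma ltxi_cat (s s' t t' : seqlexi X) : size s = size s' ->
  (s ++ t < s' ++ t' :> seqlexi X)%O = (s < s')%O || (s == s') && (t < t')%O.
Proof.
elim: s s' => [|x s IHs] [|x' s'] //= [/IHs {}IHs].
by rewrite !ltxi_cons IHs eqseq_cons; case: (comparableP x x').
Qed.

Lemma lt_lex_tuple n (i j : 'I_(#|X| ^ n)) :
  (lex_tuple i < lex_tuple j :> n.-tuplelexi X)%O = (i < j)%N.
Proof.
have le_n : total (<=%O : rel (n.-tuplelexi X)) by apply: le_total.
by rewrite /lex_tuple (leW_mono (@Order.le_enum_val _ _ le_n _)).
Qed.

Lemma lex_tuple_inj n : injective (@lex_tuple d X n).
Proof.
move=> i j eij; apply: val_inj; case: (ltngtP i j) => // ij.
  by have := lt_lex_tuple i j; rewrite eij ltxx ij.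
by have := lt_lex_tuple j i; rewrite eij ltxx ij.
Qed.

Lemma lex_tuple_bij n : bijective (@lex_tuple d X n).
Proof.
by apply: inj_card_bij (@lex_tuple_inj n) _; rewrite card_tuple card_ord.
Qed.

(** Reading [k] as a pair of digits and concatenating the corresponding tuples is
    strictly increasing in [k], as [lex_tuple] is; so composing it with the inverse
    of [lex_tuple] gives an increasing self-map of an ordinal, which is the
    identity. *)
Lemma lex_tuple_cat m n (i : 'I_(#|X| ^ m)) (j : 'I_(#|X| ^ n))
    (k : 'I_(#|X| ^ (m + n))) :
  k = mxtens_index (i, j) :> nat ->
  lex_tuple k = cat_tuple (lex_tuple i) (lex_tuple j).
Proof.
move=> ek.
have eN : #|X| ^ (m + n) = #|X| ^ m * #|X| ^ n by rewrite expnD.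
pose f p : (m + n).-tuplelexi X := cat_tuple (lex_tuple p.1) (lex_tuple p.2).
pose cut (x : 'I_(#|X| ^ (m + n))) := mxtens_unindex (cast_ord eN x).
have f_lt (x y : 'I_(#|X| ^ (m + n))) : (x < y)%N -> (f (cut x) < f (cut y))%O.
  rewrite -[x : nat]/(cast_ord eN x : nat) -[y : nat]/(cast_ord eN y : nat) /cut.
  case: (mxtens_indexP (cast_ord eN x)) => x1 x2.
  case: (mxtens_indexP (cast_ord eN y)) => y1 y2.
  rewrite !mxtens_indexK => xy.
  have -> : (f (x1, x2) < f (y1, y2))%O =
      (lex_tuple x1 < lex_tuple y1 :> m.-tuplelexi X)%O
      || (x1 == y1) && (lex_tuple x2 < lex_tuple y2 :> n.-tuplelexi X)%O.
    rewrite -(inj_eq (@lex_tuple_inj m)).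
    by apply: ltxi_cat; rewrite !size_tuple.
  rewrite !lt_lex_tuple; move: xy => /=.
  (* The case [y1 < x1] contradicts [x < y], by comparing the leading digits. *)
  case: (ltngtP x1 y1) => [//|yx|/val_inj->]; last by rewrite eqxx ltn_add2l.
  suff /ltnW : y1 * #|X| ^ n + y2 < x1 * #|X| ^ n + x2.
    by rewrite leqNgt => /negbTE->.
  rewrite (@leq_trans (y1.+1 * #|X| ^ n)) //; first by rewrite mulSnr ltn_add2l.
  by rewrite (leq_trans _ (leq_addr _ _)) // leq_mul2r yx orbT.
have [g gK Kg] := lex_tuple_bij (m + n).
pose r x := g (f (cut x)).
have r_id : r =1 id.
  apply: (@Order.mono_unique _ 'I__ 'I__).
  - exact: le_total.
  - by [].
  - apply: le_mono => x y; rewrite !ltEord => /f_lt.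
    by rewrite -lt_lex_tuple /r !Kg.
  - by [].
rewrite -[RHS]/(f (i, j) : _.-tuple X) -(Kg (f (i, j))); congr lex_tuple.
rewrite -[LHS]r_id /r; congr (g (f _)).
rewrite /cut -[RHS]mxtens_indexK; congr mxtens_unindex; exact: val_inj.
Qed.
End Lex.

Section ColoringFunctor.
Variables (d : Order.disp_t) (X : finOrderType d) (q : quandle X).

(** * Colorings of pieces *)

Lemma glue_sym m n (T : diag m n) : symmetric (@glue m n T).
Proof.
by elim: T => //= [k l p D IHD E IHE | k l k' l' D IHD E IHE] [x|x] [y|y] //=.
Qed.

Definition glued m n (T : diag m n) (f : piece T -> X) : bool :=
  [forall x, [forall y, glue x y ==> (f x == f y)]].

Lemma gluedP m n (T : diag m n) (f : piece T -> X) :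
  reflect (forall x y, glue x y -> f x = f y) (glued f).
Proof.
apply: (iffP forallP) => [h x y xy | h x].
  by have /forallP/(_ y)/implyP/(_ xy)/eqP := h x.
by apply/forallP => y; apply/implyP => /h ->.
Qed.

Definition crossed m n (T : diag m n) (f : piece T -> X) : bool :=
  all (fun x : piece T * piece T * piece T =>
    f x.2 == rtri q (f x.1.1) (f x.1.2)) (crossings T).

Definition lower_ends m n (T : diag m n) (f : piece T -> X) : m.-tuple X :=
  [tuple f (lower T i) | i < m].
Definition upper_ends m n (T : diag m n) (f : piece T -> X) : n.-tuple X :=
  [tuple f (upper T i) | i < n].

Definition fits m n (T : diag m n) (mu : m.-tuple X) (nu : n.-tuple X)
    (f : piece T -> X) : bool :=
  [&& glued f, crossed f, lower_ends f == mu & upper_ends f == nu].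

Lemma arc_of_glue m n (T : diag m n) (x y : piece T) :
  glue x y -> arc_of x = arc_of y.
Proof.
move=> xy; apply: val_inj; apply/setP => z; rewrite !inE.
by apply: same_connect; [apply/sym_connect_sym/glue_sym | apply: connect1].
Qed.

Lemma glued_arc_of m n (T : diag m n) (f : piece T -> X) (x y : piece T) :
  glued f -> arc_of x = arc_of y -> f x = f y.
Proof.
move=> /gluedP gf [/setP/(_ y)]; rewrite !inE connect0 => /connectP[p xp ->].
by elim: p x xp => //= z p IHp x /andP[/gf -> /IHp].
Qed.

Lemma arc_of_surj m n (T : diag m n) (A : Defs.arc T) : exists x, arc_of x == A.
Proof.
have /imsetP[x _ eA] := valP A.
by exists x; apply/eqP/val_inj; rewrite eA.
Qed.

(** Colorings of arcs are indexed by sets of pieces, which have no recursive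
    description; colorings of pieces follow the structure of the diagram.
    Composing with [arc_of] is a bijection from the colorings of arcs to the
    colorings of pieces that are constant along [glue]: it is injective as every
    arc contains a piece, and [glued_arc_of] gives surjectivity. *)
Lemma num_coloringsE m n (T : diag m n) mu nu :
  num_colorings q T mu nu = \sum_(f : {ffun piece T -> X}) fits mu nu f.
Proof.
pose restr (c : {ffun Defs.arc T -> X}) := [ffun x : piece T => c (arc_of x)].
have restr_inj : injective restr.
  move=> c c' /ffunP cc'; apply/ffunP => A.
  by have [x /eqP <-] := arc_of_surj A; have := cc' x; rewrite !ffunE.
transitivity #|[pred f : {ffun piece T -> X} | fits mu nu f]|; last first.
  by rewrite -sum1_card big_mkcond; apply: eq_bigr => f _; rewrite inE; case: fits.
rewrite /num_colorings -(card_imset _ restr_inj); apply: eq_card => f.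
rewrite inE; apply/imsetP/idP => [[c] | fitf].
  rewrite inE => /and3P[cc lc uc] ->; apply/and4P; split.
  - by apply/gluedP => x y /arc_of_glue xy; rewrite !ffunE xy.
  - by apply: sub_all cc => x; rewrite !ffunE.
  - by rewrite -(eqP lc); apply/eqP/eq_mktuple => i; rewrite ffunE.
  - by rewrite -(eqP uc); apply/eqP/eq_mktuple => i; rewrite ffunE.
have [gf _ _ _] := and4P fitf.
pose c := [ffun A => f (xchoose (arc_of_surj A))].
have cE x : c (arc_of x) = f x.
  by rewrite ffunE; apply: (glued_arc_of gf); apply/eqP/(xchooseP (arc_of_surj _)).
exists c; last by apply/ffunP => x; rewrite ffunE cE.
have [_ cf lf uf] := and4P fitf; rewrite inE; apply/and3P; split.
- by apply: sub_all cf => x; rewrite !cE.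
- by rewrite -(eqP lf); apply/eqP/eq_mktuple => i; rewrite cE.
- by rewrite -(eqP uf); apply/eqP/eq_mktuple => i; rewrite cE.
Qed.

(** * Counting in composites and juxtapositions *)

Definition sum_fun (A B : finType) (f : {ffun A -> X}) (g : {ffun B -> X}) :
    {ffun A + B -> X} :=
  [ffun x => match x with inl a => f a | inr b => g b end].

Lemma big_sum_fun (A B : finType) (F : {ffun A + B -> X} -> nat) :
  \sum_h F h = \sum_f \sum_g F (@sum_fun A B f g).
Proof.
rewrite pair_big /= (reindex (fun p => @sum_fun A B p.1 p.2)) //=.
exists (fun h : {ffun A + B -> X} =>
  ([ffun a => h (inl a)], [ffun b => h (inr b)])) => [[f g] | h] _ /=.
  by congr pair; apply/ffunP => x; rewrite !ffunE.
by apply/ffunP => -[x|x]; rewrite !ffunE.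
Qed.

Lemma glued_comp m l n (D : diag m l) (E : diag l n)
    (f : {ffun piece D -> X}) (g : {ffun piece E -> X}) :
  glued (T := DComp D E) (sum_fun f g)
    = [&& glued f, glued g & upper_ends f == lower_ends g].
Proof.
apply/gluedP/and3P => [h | [/gluedP gf /gluedP gg /eqP ufg]].
  split.
  - by apply/gluedP => x y xy; have := h (inl x) (inl y) xy; rewrite !ffunE.
  - by apply/gluedP => x y xy; have := h (inr x) (inr y) xy; rewrite !ffunE.
  apply/eqP/eq_mktuple => i.
  have := h (inl (upper D i)) (inr (lower E i)); rewrite !ffunE; apply => /=.
  by apply/existsP; exists i; rewrite !eqxx.
have match_ends i : f (upper D i) = g (lower E i).
  by have := congr1 (fun t => tnth t i) ufg; rewrite !tnth_mktuple.
move=> [x|x] [y|y] /=; rewrite !ffunE => xy; [exact: gf | | | exact: gg];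
  by case/existsP: xy => i /andP[/eqP <- /eqP <-]; rewrite match_ends.
Qed.

Lemma glued_tens m n m' n' (D : diag m n) (E : diag m' n')
    (f : {ffun piece D -> X}) (g : {ffun piece E -> X}) :
  glued (T := DTens D E) (sum_fun f g) = glued f && glued g.
Proof.
apply/gluedP/andP => [h | [/gluedP gf /gluedP gg]].
  split; apply/gluedP => x y xy.
  - by have := h (inl x) (inl y) xy; rewrite !ffunE.
  - by have := h (inr x) (inr y) xy; rewrite !ffunE.
by move=> [x|x] [y|y] //=; rewrite !ffunE; [apply: gf | apply: gg].
Qed.

Lemma crossed_comp m l n (D : diag m l) (E : diag l n)
    (f : {ffun piece D -> X}) (g : {ffun piece E -> X}) :
  crossed (T := DComp D E) (sum_fun f g) = crossed f && crossed g.
Proof.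
by rewrite /crossed all_cat !all_map; congr andb; apply: eq_all => x /=;
  rewrite !ffunE.
Qed.

Lemma crossed_tens m n m' n' (D : diag m n) (E : diag m' n')
    (f : {ffun piece D -> X}) (g : {ffun piece E -> X}) :
  crossed (T := DTens D E) (sum_fun f g) = crossed f && crossed g.
Proof.
by rewrite /crossed all_cat !all_map; congr andb; apply: eq_all => x /=;
  rewrite !ffunE.
Qed.

(** The only middle color that contributes to a pair [(f, g)] of colorings is the
    one that [f] induces on its upper ends, and gluing forces [g] to induce the
    same one on its lower ends. *)
Lemma num_colorings_comp m k n (D : diag m k) (E : diag k n) mu nu :
  num_colorings q (DComp D E) mu nu =
  \sum_rho num_colorings q D mu rho * num_colorings q E rho nu.
Proof.
under eq_bigr do rewrite !num_coloringsE big_distrlr /=.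
rewrite num_coloringsE big_sum_fun [RHS]exchange_big /=.
apply: eq_bigr => f _; rewrite [RHS]exchange_big /=; apply: eq_bigr => g _.
have -> : fits mu nu (sum_fun f g : piece (DComp D E) -> X) =
    fits mu (upper_ends f) f && fits (upper_ends f) nu g.
  rewrite /fits glued_comp crossed_comp eqxx andbT [lower_ends g == _]eq_sym.
  have -> : lower_ends (T := DComp D E) (sum_fun f g) = lower_ends f.
    by apply: eq_mktuple => i; rewrite ffunE.
  have -> : upper_ends (T := DComp D E) (sum_fun f g) = upper_ends g.
    by apply: eq_mktuple => i; rewrite ffunE.
  case: (glued f); case: (glued g); case: (crossed f); case: (crossed g);
    rewrite ?andbF //=.
  by rewrite andbCA.
rewrite (bigD1 (upper_ends f)) //= big1 ?addn0 ?mulnb // => rho ne.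
by rewrite /fits [upper_ends f == rho]eq_sym (negbTE ne) !andbF.
Qed.

Lemma cat_tuple_eq m n (s s' : m.-tuple X) (t t' : n.-tuple X) :
  (cat_tuple s t == cat_tuple s' t') = (s == s') && (t == t').
Proof. by rewrite -!val_eqE /= eqseq_cat ?size_tuple. Qed.

Lemma num_colorings_tens m n m' n' (D : diag m n) (E : diag m' n')
    (mu : m.-tuple X) (nu : n.-tuple X) (mu' : m'.-tuple X) (nu' : n'.-tuple X) :
  num_colorings q (DTens D E) (cat_tuple mu mu') (cat_tuple nu nu') =
  num_colorings q D mu nu * num_colorings q E mu' nu'.
Proof.
rewrite !num_coloringsE big_distrlr big_sum_fun /=.
apply: eq_bigr => f _; apply: eq_bigr => g _; rewrite mulnb; congr nat_of_bool.
rewrite /fits glued_tens crossed_tens.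
have -> : lower_ends (T := DTens D E) (sum_fun f g) =
    cat_tuple (lower_ends f) (lower_ends g).
  apply: eq_from_tnth => i; rewrite tnth_mktuple.
  by case: (split_ordP i) => j ->; rewrite ?tnth_lshift ?tnth_rshift tnth_mktuple
    /= ?(unsplitK (inl j)) ?(unsplitK (inr j)) ffunE.
have -> : upper_ends (T := DTens D E) (sum_fun f g) =
    cat_tuple (upper_ends f) (upper_ends g).
  apply: eq_from_tnth => i; rewrite tnth_mktuple.
  by case: (split_ordP i) => j ->; rewrite ?tnth_lshift ?tnth_rshift tnth_mktuple
    /= ?(unsplitK (inl j)) ?(unsplitK (inr j)) ffunE.
rewrite !cat_tuple_eq.
case: (glued f); case: (glued g); case: (crossed f); case: (crossed g);
  rewrite ?andbF //=.
by rewrite andbACA -!andbA.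
Qed.

Lemma cat_mktuple m n (F : 'I_(m + n) -> X) :
  mktuple F = cat_tuple [tuple F (lshift n i) | i < m]
                        [tuple F (rshift m i) | i < n].
Proof.
apply: eq_from_tnth => i; rewrite tnth_mktuple.
by case: (split_ordP i) => j ->; rewrite ?tnth_lshift ?tnth_rshift tnth_mktuple.
Qed.

Lemma tuple_split m n (t : (m + n).-tuple X) :
  exists (v : m.-tuple X) (w : n.-tuple X), t = cat_tuple v w.
Proof.
exists [tuple tnth t (lshift n x) | x < m], [tuple tnth t (rshift m x) | x < n].
by rewrite -(cat_mktuple (tnth t)); apply: eq_from_tnth => x; rewrite tnth_mktuple.
Qed.

(** * Parametrized families of colorings *)

(** A span from [X ^ m] to [X ^ n] whose matrix of fiber cardinals is the coloring
    matrix of [T]: the points of [S] stand for the colorings of [T]. *)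
Definition presents m n (T : diag m n) (S : finType)
    (l : S -> m.-tuple X) (u : S -> n.-tuple X) : Prop :=
  forall mu nu, num_colorings q T mu nu = \sum_s (l s == mu) && (u s == nu).

(** Reindexing along an injection [h] outside whose image [F] vanishes; [P] is the
    image, and [g] an inverse there. *)
Lemma sum_bij (S S' : finType) (P : pred S) (F : S -> nat) (F' : S' -> nat)
    (h : S' -> S) (g : S -> S') :
  (forall s, ~~ P s -> F s = 0) -> (forall s', P (h s')) -> cancel h g ->
  (forall s, P s -> h (g s) = s) -> (forall s', F (h s') = F' s') ->
  \sum_s F s = \sum_s' F' s'.
Proof.
move=> F0 Ph hK gK FF'; rewrite (bigID P) /= [X in _ + X]big1 // addn0.
rewrite (reindex_onto h g) //=; apply: eq_big => s' => [|_]; last exact: FF'.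
by rewrite Ph hK eqxx.
Qed.

(** The colorings themselves parametrize the colorings; [S] is a more convenient
    copy, and [h] writes its points as colorings of the pieces. *)
Lemma presents_pieces m n (T : diag m n) (S : finType)
    (h : S -> {ffun piece T -> X}) (g : {ffun piece T -> X} -> S) :
  cancel h g -> (forall s, glued (h s) && crossed (h s)) ->
  (forall f : {ffun piece T -> X}, glued f -> crossed f -> h (g f) = f) ->
  presents T (fun s => lower_ends (h s)) (fun s => upper_ends (h s)).
Proof.
move=> hK hok gK mu nu; rewrite num_coloringsE.
apply: (sum_bij (P := fun f : {ffun piece T -> X} => glued f && crossed f)
  (h := h) (g := g)) => //.
- by move=> f; rewrite /fits andbA => /negbTE ->.
- by move=> f /andP[]; apply: gK.
- by move=> s; rewrite /fits andbA hok.
Qed.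

Lemma presents_iso m n (T : diag m n) (S S' : finType) l u l' u'
    (h : S -> S') (g : S' -> S) :
  cancel h g -> cancel g h -> l' =1 l \o g -> u' =1 u \o g ->
  @presents m n T S l u -> @presents m n T S' l' u'.
Proof.
move=> hK gK el eu pT mu nu; rewrite pT.
apply: (sum_bij (P := predT) (h := g) (g := h)) => //.
by move=> s; rewrite el eu.
Qed.

Lemma eq_presents m n (T : diag m n) (S : finType) l u l' u' :
  l' =1 l -> u' =1 u -> @presents m n T S l u -> @presents m n T S l' u'.
Proof. by move=> el eu; apply: (presents_iso (h := id) (g := id)). Qed.

Lemma presents_eq m n (T T' : diag m n) (S : finType) l u :
  @presents m n T S l u -> @presents m n T' S l u ->
  forall mu nu, num_colorings q T mu nu = num_colorings q T' mu nu.
Proof. by move=> pT pT' mu nu; rewrite pT pT'. Qed.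

Lemma presents_id n : presents (DId n) id id.
Proof.
pose h (t : n.-tuple X) : {ffun piece (DId n) -> X} := [ffun i => tnth t i].
have hK : cancel h (fun f => [tuple f i | i < n]).
  by move=> t; apply: eq_from_tnth => i; rewrite tnth_mktuple ffunE.
apply: (eq_presents _ _ (presents_pieces hK _ _)).
- by move=> t; rewrite -{1}[t]hK.
- by move=> t; rewrite -{1}[t]hK.
- by move=> t; rewrite andbT; apply/gluedP.
- by move=> f _ _; apply/ffunP => i; rewrite ffunE tnth_mktuple.
Qed.

Lemma presents_cup : presents DCup (fun _ : X => [tuple]) (fun x => [tuple x; x]).
Proof.
pose h (x : X) : {ffun piece DCup -> X} := [ffun => x].
have hK : cancel h (@^~ tt) by move=> x; rewrite ffunE.
apply: (eq_presents _ _ (presents_pieces hK _ _)).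
- by move=> x; apply: eq_from_tnth => -[].
- move=> x; apply: eq_from_tnth => i; rewrite tnth_mktuple ffunE.
  by case: i => -[|[|[]]].
- by move=> x; rewrite andbT; apply/gluedP.
- by move=> f _ _; apply/ffunP => -[]; rewrite ffunE.
Qed.

Lemma presents_cap : presents DCap (fun x : X => [tuple x; x]) (fun _ => [tuple]).
Proof.
pose h (x : X) : {ffun piece DCap -> X} := [ffun => x].
have hK : cancel h (@^~ tt) by move=> x; rewrite ffunE.
apply: (eq_presents _ _ (presents_pieces hK _ _)).
- move=> x; apply: eq_from_tnth => i; rewrite tnth_mktuple ffunE.
  by case: i => -[|[|[]]].
- by move=> x; apply: eq_from_tnth => -[].
- by move=> x; rewrite andbT; apply/gluedP.
- by move=> f _ _; apply/ffunP => -[]; rewrite ffunE.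
Qed.

(** At a crossing the over-color and the lower under-color are free. *)
Lemma presents_Xp :
  presents DXp (fun s : X * X => [tuple s.1; s.2])
    (fun s => [tuple rtri q s.1 s.2; s.1]).
Proof.
pose h (s : X * X) : {ffun piece DXp -> X} :=
  [ffun x => match x with
   | None => s.1 | Some false => s.2 | Some true => rtri q s.1 s.2 end].
have hK : cancel h (fun f => (f None, f (Some false))).
  by case=> a b; rewrite !ffunE.
apply: (eq_presents _ _ (presents_pieces hK _ _)).
- move=> x; apply: eq_from_tnth => i; rewrite tnth_mktuple ffunE.
  by case: i => -[|[|[]]].
- move=> x; apply: eq_from_tnth => i; rewrite tnth_mktuple ffunE.
  by case: i => -[|[|[]]].
- by move=> s; apply/andP; split; [apply/gluedP | rewrite /crossed /= !ffunE eqxx].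
- move=> f _; rewrite /crossed /= andbT => /eqP fX.
  by apply/ffunP => -[[]|]; rewrite ffunE.
Qed.

Lemma presents_Xm :
  presents DXm (fun s : X * X => [tuple s.2; s.1])
    (fun s => [tuple s.1; rtri q s.1 s.2]).
Proof.
pose h (s : X * X) : {ffun piece DXm -> X} :=
  [ffun x => match x with
   | None => s.1 | Some false => s.2 | Some true => rtri q s.1 s.2 end].
have hK : cancel h (fun f => (f None, f (Some false))).
  by case=> a b; rewrite !ffunE.
apply: (eq_presents _ _ (presents_pieces hK _ _)).
- move=> x; apply: eq_from_tnth => i; rewrite tnth_mktuple ffunE.
  by case: i => -[|[|[]]].
- move=> x; apply: eq_from_tnth => i; rewrite tnth_mktuple ffunE.
  by case: i => -[|[|[]]].
- by move=> s; apply/andP; split; [apply/gluedP | rewrite /crossed /= !ffunE eqxx].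
- move=> f _; rewrite /crossed /= andbT => /eqP fX.
  by apply/ffunP => -[[]|]; rewrite ffunE.
Qed.

(** Spans compose by pullback: [R], with its projections [p] and [p'], is a
    pullback of [u] and [l'], and [g] is the map from the fiber product that
    makes it so. *)
Lemma presents_comp m k n (D : diag m k) (E : diag k n) (S S' R : finType)
    l u l' u' (p : R -> S) (p' : R -> S') (g : S -> S' -> R) :
  @presents m k D S l u -> @presents k n E S' l' u' ->
  (forall r, u (p r) = l' (p' r)) ->
  (forall r, g (p r) (p' r) = r) ->
  (forall s s', u s = l' s' -> p (g s s') = s /\ p' (g s s') = s') ->
  presents (DComp D E) (fun r => l (p r)) (fun r => u' (p' r)).
Proof.
move=> pD pE sq gK pK mu nu; rewrite num_colorings_comp.
under eq_bigr do rewrite pD pE big_distrlr pair_big /=.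
rewrite exchange_big /=.
apply: (sum_bij (P := fun x => u x.1 == l' x.2) (h := fun r => (p r, p' r))
  (g := fun x => g x.1 x.2)) => //=.
- move=> [s s'] /= ne; apply: big1 => rho _; apply/eqP.
  rewrite muln_eq0 !eqb0 !negb_and.
  case: (u s =P rho) => [us|]; last by rewrite orbT.
  by rewrite -us [l' s' == _]eq_sym ne orbT.
- by move=> r; rewrite sq.
- by move=> [s s'] /= /eqP/pK[-> ->].
- move=> r; rewrite (bigD1 (u (p r))) //= big1 ?addn0; last first.
    by move=> rho ne; rewrite [u _ == _]eq_sym (negbTE ne) andbF.
  by rewrite eqxx -sq eqxx andbT mulnb.
Qed.

(** The most common pullback: a coloring of the lower diagram extends uniquely,
    as when the upper one is built from crossings. *)
Lemma presents_comp_fun m k n (D : diag m k) (E : diag k n) (S S' : finType)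
    l u l' u' (h : S -> S') :
  @presents m k D S l u -> @presents k n E S' l' u' ->
  injective l' -> (forall s, u s = l' (h s)) ->
  presents (DComp D E) l (fun s => u' (h s)).
Proof.
move=> pD pE inj_l' uh.
apply: (presents_comp (p := id) (p' := h) (g := fun s _ => s) pD pE) => // s s'.
by rewrite uh => /inj_l' ->.
Qed.

Lemma presents_tens m n m' n' (D : diag m n) (E : diag m' n') (S S' : finType)
    l u l' u' :
  @presents m n D S l u -> @presents m' n' E S' l' u' ->
  presents (DTens D E) (fun s : S * S' => cat_tuple (l s.1) (l' s.2))
    (fun s => cat_tuple (u s.1) (u' s.2)).
Proof.
move=> pD pE mu nu; have [mu1 [mu2 ->]] := tuple_split mu.
have [nu1 [nu2 ->]] := tuple_split nu.
rewrite num_colorings_tens pD pE big_distrlr pair_big /=.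
apply: eq_bigr => s _; rewrite mulnb !cat_tuple_eq; congr nat_of_bool.
by rewrite andbACA.
Qed.

(** * Invariance under the local moves *)

Hypothesis q_invol : involutory q.

Lemma rtriK b : involutive (rtri q b).
Proof. by move=> a; rewrite (q_invol _ b) quandle2l. Qed.

Definition crossing (e : bool) : diag 2 2 := if e then DXp else DXm.

Lemma tX_crossing e : tX e = tcls (crossing e).
Proof. by case: e. Qed.

(** Both crossings, parametrized by their lower colors from left to right. *)
Lemma presents_crossing e :
  presents (crossing e) (fun s : X * X => [tuple s.1; s.2])
    (fun s => if e then [tuple rtri q s.1 s.2; s.1]
              else [tuple s.2; rtri q s.2 s.1]).
Proof.
case: e; first exact: presents_Xp.
by apply: (presents_iso (h := fun s => (s.2, s.1)) (g := fun s => (s.2, s.1))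
  _ _ _ _ presents_Xm); case.
Qed.

Lemma presents_id1 : presents (DId 1) (fun a : X => [tuple a]) (fun a => [tuple a]).
Proof.
refine (presents_iso (h := @thead 0 X) (g := fun a => [tuple a]) _ _ _ _
  (@presents_id 1)) => //.
by case/tupleP=> a t; apply: val_inj; rewrite /= tuple0.
Qed.

Lemma presents_id2 :
  presents (DId 2) (fun s : X * X => [tuple s.1; s.2]) (fun s => [tuple s.1; s.2]).
Proof.
refine (presents_iso (h := fun t : 2.-tuple X => (thead t, tnth t ord_max))
  (g := fun s : X * X => [tuple s.1; s.2]) _ _ _ _ (@presents_id 2)) => //.
- move=> t; apply: eq_from_tnth => -[[|[|[]]] // lti] /=.
    by congr (tnth t _); apply: val_inj.
  by congr (tnth t _); apply: val_inj.
- by case.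
Qed.

(** A zigzag has three strands joined end to end, hence a single free color. *)
Lemma zigzag_l mu nu :
  num_colorings q (DComp (DTens DCup (DId 1)) (DTens (DId 1) DCap)) mu nu
  = num_colorings q (DId 1) mu nu.
Proof.
have pD := presents_tens presents_cup presents_id1.
have pE := presents_tens presents_id1 presents_cap.
apply: (presents_eq _ presents_id1).
apply: (eq_presents _ _ (presents_comp (p := fun a : X => (a, a))
  (p' := fun a : X => (a, a)) (g := fun s _ => s.1) pD pE _ _ _)).
- by move=> a; apply: val_inj.
- by move=> a; apply: val_inj.
- by move=> a; apply: val_inj.
- by [].
- by move=> [y a] [b z] [-> -> ->].
Qed.

Lemma zigzag_r mu nu :
  num_colorings q (DComp (DTens (DId 1) DCup) (DTens DCap (DId 1))) mu nu
  = num_colorings q (DId 1) mu nu.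
Proof.
have pD := presents_tens presents_id1 presents_cup.
have pE := presents_tens presents_cap presents_id1.
apply: (presents_eq _ presents_id1).
apply: (eq_presents _ _ (presents_comp (p := fun a : X => (a, a))
  (p' := fun a : X => (a, a)) (g := fun s _ => s.1) pD pE _ _ _)).
- by move=> a; apply: val_inj.
- by move=> a; apply: val_inj.
- by move=> a; apply: val_inj.
- by [].
- by move=> [y a] [b z] [-> -> ->].
Qed.

(** Each side is parametrized by the color [a] of the straight strand and the color
    of the cup before its crossing.  Going from left to right moves the crossing
    to the other leg, and the cup color [y] becomes [rtri q a y] when the strand
    passes over the cup ([e = true]) and stays [y] when it passes under; this
    change of parameters is [h], with inverse [g]. *)
Lemma crossing_past_cup e mu nu :
  num_colorings q (DComp (DTens (DId 1) DCup) (DTens (crossing e) (DId 1))) mu nu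
  = num_colorings q
      (DComp (DTens DCup (DId 1)) (DTens (DId 1) (crossing (~~ e)))) mu nu.
Proof.
have pL := presents_comp_fun (presents_tens presents_id1 presents_cup)
  (presents_tens (presents_crossing e) presents_id1)
  (h := fun s => ((s.1, s.2), s.2)) _ _.
have pR := presents_comp_fun (presents_tens presents_cup presents_id1)
  (presents_tens presents_id1 (presents_crossing (~~ e)))
  (h := fun s => (s.1, (s.1, s.2))) _ _.
pose h (s : X * X) := (if e then rtri q s.1 s.2 else s.2, s.1).
pose g (s : X * X) := (s.2, if e then rtri q s.2 s.1 else s.1).
apply: (presents_eq (presents_iso (h := h) (g := g) _ _ _ _ (pL _ _)) (pR _ _)).
- by case=> a y; rewrite /h /g /=; case: (e); rewrite ?rtriK.
- by case=> a y; rewrite /h /g /=; case: (e); rewrite ?rtriK.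
- by move=> s; apply: val_inj.
- by case=> a y; apply: val_inj; rewrite /g /=; case: (e); rewrite /= ?rtriK.
- by move=> [[a b] c] [[a' b'] c'] [-> -> ->].
- by move=> s; apply: val_inj.
- by move=> [a [b c]] [a' [b' c']] [-> -> ->].
- by move=> s; apply: val_inj.
Qed.

Lemma curl e mu nu :
  num_colorings q (DComp DCup (crossing e)) mu nu = num_colorings q DCup mu nu.
Proof.
apply: (presents_eq _ presents_cup).
apply: (eq_presents _ _ (presents_comp_fun (h := fun x => (x, x))
  presents_cup (presents_crossing e) _ _)) => //.
- by move=> x; case: e; rewrite /= quandle1.
- by move=> [a b] [a' b'] [-> ->].
Qed.

Lemma crossing_cancel e mu nu :
  num_colorings q (DComp (crossing e) (crossing (~~ e))) mu nu
  = num_colorings q (DId 2) mu nu.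
Proof.
apply: (presents_eq _ presents_id2).
pose h (s : X * X) := if e then (rtri q s.1 s.2, s.1) else (s.2, rtri q s.2 s.1).
apply: (eq_presents _ _ (presents_comp_fun (h := h)
  (presents_crossing e) (presents_crossing (~~ e)) _ _)) => //.
- by move=> s; rewrite /h; case: (e); rewrite /= rtriK.
- by move=> [a b] [a' b'] [-> ->].
- by move=> s; rewrite /h; case: (e).
Qed.

(** Both sides are functions of the lower colors [a, b, c].  Their upper colors
    are [(a > b) > (a > c), a > b, a] on the left and
    [a > (b > c), a > b, a] on the right, writing [>] for [rtri q]. *)
Lemma braid_move mu nu :
  num_colorings q (DComp (DComp (DTens DXp (DId 1)) (DTens (DId 1) DXp))
    (DTens DXp (DId 1))) mu nu
  = num_colorings q (DComp (DComp (DTens (DId 1) DXp) (DTens DXp (DId 1)))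
    (DTens (DId 1) DXp)) mu nu.
Proof.
have p12 := presents_tens presents_Xp presents_id1.
have p23 := presents_tens presents_id1 presents_Xp.
have inj12 : injective (fun s : X * X * X =>
    cat_tuple [tuple s.1.1; s.1.2] [tuple s.2]).
  by move=> [[a b] c] [[a' b'] c'] [-> -> ->].
have inj23 : injective (fun s : X * (X * X) =>
    cat_tuple [tuple s.1] [tuple s.2.1; s.2.2]).
  by move=> [a [b c]] [a' [b' c']] [-> -> ->].
have pL2 := presents_comp_fun p12 p23
  (h := fun s => (rtri q s.1.1 s.1.2, (s.1.1, s.2))) inj23.
have pL := presents_comp_fun (pL2 _) p12
  (h := fun s => ((rtri q s.1.1 s.1.2, rtri q s.1.1 s.2), s.1.1)) inj12.
have pR2 := presents_comp_fun p23 p12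
  (h := fun s => ((s.1, rtri q s.2.1 s.2.2), s.2.1)) inj12.
have pR := presents_comp_fun (pR2 _) p23
  (h := fun s => (rtri q s.1 (rtri q s.2.1 s.2.2), (s.1, s.2.1))) inj23.
apply: (presents_eq (presents_iso (h := fun s => (s.1.1, (s.1.2, s.2)))
  (g := fun s => ((s.1, s.2.1), s.2.2)) _ _ _ _ (pL _ _)) (pR _ _)).
- by case=> -[].
- by case=> a [].
- by case=> a [b c]; apply: val_inj.
- by case=> a [b c]; apply: val_inj; rewrite /= quandle3.
- by move=> s; apply: val_inj.
- by move=> s; apply: val_inj.
- by move=> s; apply: val_inj.
- by move=> s; apply: val_inj.
Qed.

(** * Coloring matrices *)

Notation mx_heq1 := (heq1 (H := fun m n => 'M[nat]_(m, n))).

Lemma num_colorings_id n (mu nu : n.-tuple X) :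
  num_colorings q (DId n) mu nu = (mu == nu).
Proof.
rewrite presents_id (bigD1 mu) //= big1 ?addn0 ?eqxx // => t /negbTE tmu.
by rewrite tmu.
Qed.

Lemma coloring_mx_id n : coloring_mx q (DId n) = 1%:M%R.
Proof.
apply/matrixP => i j; rewrite !mxE num_colorings_id.
by rewrite (inj_eq (@lex_tuple_inj d X n)); case: eqP.
Qed.

Lemma coloring_mx_comp m k n (D : diag m k) (E : diag k n) :
  coloring_mx q (DComp D E) = (coloring_mx q D *m coloring_mx q E)%R.
Proof.
apply/matrixP => i j; rewrite !mxE num_colorings_comp.
rewrite (reindex (@lex_tuple d X k)) /=; last exact/onW_bij/lex_tuple_bij.
by apply: eq_bigr => r _; rewrite !mxE.
Qed.

Lemma coloring_mx_tens m n m' n' (D : diag m n) (E : diag m' n') :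
  mx_heq1 (coloring_mx q (DTens D E))
    (kronmx (coloring_mx q D) (coloring_mx q E)).
Proof.
apply: heq1_mx; rewrite ?expnD // => i j i' j'.
case: (mxtens_indexP i') => i1 i2; case: (mxtens_indexP j') => j1 j2 ei ej.
rewrite !mxE !mxtens_indexK (lex_tuple_cat ei) (lex_tuple_cat ej).
exact: num_colorings_tens.
Qed.

Lemma heq1_mulmx m l n (A : 'M[nat]_(m, l)) (B : 'M[nat]_(l, n))
    m' l' n' (A' : 'M[nat]_(m', l')) (B' : 'M[nat]_(l', n')) :
  mx_heq1 A A' -> mx_heq1 B B' -> mx_heq1 (A *m B)%R (A' *m B')%R.
Proof.
move=> AA' BB'; have [em el] := heq1_ob AA'; have [_ en] := heq1_ob BB'.
by subst m' l' n'; rewrite (heq1_eq AA') (heq1_eq BB').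
Qed.

Lemma heq1_kronmx m n p r (A : 'M[nat]_(m, n)) (B : 'M[nat]_(p, r))
    m' n' p' r' (A' : 'M[nat]_(m', n')) (B' : 'M[nat]_(p', r')) :
  mx_heq1 A A' -> mx_heq1 B B' -> mx_heq1 (kronmx A B) (kronmx A' B').
Proof. by case=> {m' n' A'}; case. Qed.

Lemma heq1_coloring_mx_tens m n p r m' n' p' r' (S : diag m n) (T : diag p r)
    (A : 'M[nat]_(m', n')) (B : 'M[nat]_(p', r')) :
  mx_heq1 (coloring_mx q S) A -> mx_heq1 (coloring_mx q T) B ->
  mx_heq1 (coloring_mx q (DTens S T)) (kronmx A B).
Proof.
by move=> SA TB; apply: heq1_trans (coloring_mx_tens S T) (heq1_kronmx SA TB).
Qed.

(** Each generating equation of [deq] is sent to the corresponding law of matrix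
    products and Kronecker products. *)
Lemma coloring_mx_deq m n m' n' (S : diag m n) (T : diag m' n') :
  deq S T -> mx_heq1 (coloring_mx q S) (coloring_mx q T).
Proof.
elim=> {m n m' n' S T}.
- by [].
- by move=> m n m' n' S T _; apply: heq1_sym.
- by move=> m n m' n' m'' n'' S T U _ ST _; apply: heq1_trans ST.
- move=> m l n m' l' n' S T S' T' _ SS' _ TT'; rewrite !coloring_mx_comp.
  exact: heq1_mulmx.
- move=> m n p r m' n' p' r' S T S' T' _ SS' _ TT'.
  apply: heq1_trans (heq1_coloring_mx_tens SS' TT') _.
  exact/heq1_sym/coloring_mx_tens.
- by move=> *; rewrite !coloring_mx_comp mulmxA.
- by move=> *; rewrite coloring_mx_comp coloring_mx_id mul1mx.
- by move=> *; rewrite coloring_mx_comp coloring_mx_id mulmx1.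
- move=> m n; apply: heq1_trans (coloring_mx_tens _ _) _.
  by rewrite !coloring_mx_id kronmx_id expnD.
- move=> m l n m' l' n' S T S' T'.
  apply: heq1_trans (coloring_mx_tens _ _) _.
  rewrite !coloring_mx_comp kronmx_mul; apply: heq1_sym.
  by apply: heq1_mulmx; apply: coloring_mx_tens.
- move=> m n p r s t S T U.
  apply: heq1_trans (heq1_coloring_mx_tens (coloring_mx_tens S T) (Heq1 _)) _.
  apply: heq1_trans (kronmxA _ _ _) _; apply: heq1_sym.
  exact: (heq1_coloring_mx_tens (Heq1 _) (coloring_mx_tens T U)).
- move=> m n S; apply: heq1_trans (coloring_mx_tens _ _) _.
  by rewrite coloring_mx_id; apply: kronmx_1l.
- move=> m n S; apply: heq1_trans (coloring_mx_tens _ _) _.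
  by rewrite coloring_mx_id; apply: kronmx_1r.
Qed.

(** * The functor *)

Definition tangle_mx m n (f : thom m n) : 'M[nat]_(#|X| ^ m, #|X| ^ n) :=
  coloring_mx q (trepr f).

Lemma tangle_mx_cls m n (T : diag m n) : tangle_mx (tcls T) = coloring_mx q T.
Proof. exact/heq1_eq/coloring_mx_deq/trepr_cls. Qed.

Lemma tangle_mx_id n : tangle_mx (tid n) = 1%:M%R.
Proof. by rewrite tangle_mx_cls coloring_mx_id. Qed.

Lemma tangle_mx_comp m l n (f : thom m l) (g : thom l n) :
  tangle_mx (tcomp f g) = (tangle_mx f *m tangle_mx g)%R.
Proof. by rewrite tangle_mx_cls coloring_mx_comp. Qed.

Lemma tangle_mx_tens m n m' n' (f : thom m n) (f' : thom m' n') :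
  mx_heq1 (tangle_mx (ttens f f')) (kronmx (tangle_mx f) (tangle_mx f')).
Proof. by rewrite tangle_mx_cls; apply: coloring_mx_tens. Qed.

Lemma tangle_mx_move m n (f g : thom m n) : move f g -> tangle_mx f = tangle_mx g.
Proof.
by case=> *; rewrite ?tX_crossing ?tangle_mx_comp /tid /tcup /tcap /tXp ?ttens_cls;
  rewrite !tangle_mx_cls -?coloring_mx_comp;
  apply/matrixP => i j; rewrite !mxE;
  [ exact: zigzag_l | exact/esym/zigzag_r | exact: crossing_past_cup
  | exact: curl | exact: crossing_cancel | exact: braid_move ].
Qed.

(** A cell is a composite of moves and of their inverses, so it yields an equality
    of matrices. *)
Lemma tangle_mx_cell m n (f g : thom m n) : cell f g -> tangle_mx f = tangle_mx g.
Proof.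
elim=> {m n f g} //.
- by move=> m n f g /tangle_mx_move.
- by move=> m n f g /tangle_mx_move.
- by move=> m n f g h _ -> _ ->.
- by move=> m l n f f' g g' _ ff' _ gg'; rewrite !tangle_mx_comp ff' gg'.
- move=> m n m' n' f g f' g' _ fg _ fg'; apply: heq1_eq.
  apply: heq1_trans (tangle_mx_tens f f') _; rewrite fg fg'.
  exact/heq1_sym/tangle_mx_tens.
Qed.

Definition coloring_2functor : twoFunctor Tang MatN.
Proof.
apply: (@TwoFunctor Tang MatN (fun n => #|X| ^ n) tangle_mx
  (fun m n f g x => tangle_mx_cell (crepr x))).
- exact: tangle_mx_id.
- exact: tangle_mx_comp.
- by move=> * /=; apply: boolp.Prop_irrelevance.
- by move=> * /=; apply: boolp.Prop_irrelevance.
- by move=> *; apply: heq2_eq; rewrite /= tangle_mx_comp.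
Defined.

Definition coloring_functor : mon2Functor Tang MatN.
Proof.
apply: (@Mon2Functor Tang MatN coloring_2functor).
- exact: expn0.
- exact: expnD.
- exact: tangle_mx_tens.
- by move=> *; apply/heq2_eq/tangle_mx_tens.
Defined.
End ColoringFunctor.

Theorem theorem6p1 (d : Order.disp_t) (X : finOrderType d) (q : quandle X)
    (q_invol : involutory q) :
  exists Col : mon2Functor Tang MatN,
    (forall n : nat, Col n = #|X| ^ n) /\
    (forall (m n : nat) (T : diag m n),
       heq1 (H := @mor MatN) (fun1 Col (tcls T : @mor Tang m n))
                             (coloring_mx q T)).
Proof.
exists (coloring_functor q_invol); split=> // m n T.
by rewrite -(tangle_mx_cls q T).
Qed.
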